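(* Let $\lambda, x \in \mathbb{C}$. For every integer $n\ge 0$ and every positive integer $d$, $$\beta_n(x\mid\lambda)=d^{\,n-1}\sum_{a=0}^{d-1}\beta_n\left(\frac{a+x}{d}\,\Big|\,\frac{\lambda}{d}\right).$$
   Context: For $\lambda,x\in\mathbb{C}$ and an integer $n\ge 0$, put $(x\mid\lambda)_n = x(x-\lambda)(x-2\lambda)\cdots(x-(n-1)\lambda)$, with $(x\mid\lambda)_0=1$. As a formal power series in $t$, $(1+\lambda t)^{x/\lambda}=\sum_{n\ge0}(x\mid\lambda)_n\frac{t^n}{n!}$ (for $\lambda=0$ this is read as the limit $e^{xt}$). The Carlitz degenerate Bernoulli polynomials $\beta_n(x\mid\lambda)$ are defined by $$\frac{t}{(1+\lambda t)^{1/\lambda}-1}(1+\lambda t)^{x/\lambda}=\sum_{n=0}^{\infty}\beta_n(x\mid\lambda)\frac{t^n}{n!}.$$ *)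

(* Defs.v *)
From mathcomp Require Import all_boot all_order all_algebra.
Set Implicit Arguments.
Unset Strict Implicit.
Unset Printing Implicit Defensive.
Import Order.TTheory GRing.Theory Num.Theory.
Local Open Scope ring_scope.

(* A formal power series is the sequence of its coefficients. *)

Section FormalPowerSeries.
Variable F : fieldType.
Implicit Types f g h : nat -> F.

Definition fps_one : nat -> F := fun n => (n == 0%N)%:R.

Definition fps_t : nat -> F := fun n => (n == 1%N)%:R.

Definition fps_sub f g : nat -> F := fun n => f n - g n.

Definition fps_mul f g : nat -> F := fun n => \sum_(i < n.+1) f i * g (n - i)%N.

(* [f / t], for a series [f] without constant term *)
Definition fps_divt f : nat -> F := fun n => f n.+1.

(* The first [n] coefficients of [1 / f]; the recurrence is the equation
   [\sum_(i <= k) g_i f_(k - i) = (k == 0)] solved for [g_k]. *)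
Fixpoint fps_inv_seq f (n : nat) : seq F :=
  if n is k.+1 then
    let s := fps_inv_seq f k in
    rcons s (((k == 0%N)%:R - \sum_(i < k) s`_i * f (k - i)%N) / f 0%N)
  else [::].

(* [1 / f], for a series [f] with nonzero constant term *)
Definition fps_inv f : nat -> F := fun n => (fps_inv_seq f n.+1)`_n.

(* The exponential generating function of a sequence *)
Definition egf (a : nat -> F) : nat -> F := fun n => a n / n`!%:R.

Lemma size_fps_inv_seq f n : size (fps_inv_seq f n) = n.
Proof. by elim: n => //= n IHn; rewrite size_rcons IHn. Qed.

Lemma nth_fps_inv_seq f n i : (i < n)%N -> (fps_inv_seq f n)`_i = fps_inv f i.
Proof.
elim: n => // n IHn; rewrite ltnS leq_eqVlt => /predU1P[-> //|lt_in].
by rewrite /= nth_rcons size_fps_inv_seq lt_in IHn.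
Qed.

Lemma fps_mulV f : f 0%N != 0 -> fps_mul (fps_inv f) f =1 fps_one.
Proof.
move=> f0 n; rewrite /fps_mul big_ord_recr /= subnn.
rewrite {2}/fps_inv /= nth_rcons size_fps_inv_seq ltnn eqxx divfK //.
rewrite [X in X + _](eq_bigr (fun i : 'I_n => (fps_inv_seq f n)`_i * f (n - i)%N)).
  by rewrite addrC subrK.
by move=> i _; rewrite nth_fps_inv_seq.
Qed.

End FormalPowerSeries.

Section DegenerateBernoulli.
Variable F : fieldType.
Implicit Types lam x : F.

(* The generalized falling factorial [(x | lam)_n] *)
Definition gen_ffact lam x (n : nat) : F := \prod_(i < n) (x - i%:R * lam).

(* [(1 + lam t)^(x / lam)]; for [lam = 0] this is [e^(x t)] *)
Definition deg_exp lam x : nat -> F := egf (gen_ffact lam x).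

(* [t / ((1 + lam t)^(1 / lam) - 1)]. The denominator has constant term [0]
   and linear coefficient [1], so one factor [t] is cancelled. *)
Definition deg_bern_kernel lam : nat -> F :=
  fps_inv (fps_divt (fps_sub (deg_exp lam 1) (fps_one F))).

(* The Carlitz degenerate Bernoulli polynomial [beta_n (x | lam)]:
   [n!] times the coefficient of [t^n] *)
Definition deg_bern (n : nat) lam x : F :=
  n`!%:R * fps_mul (deg_bern_kernel lam) (deg_exp lam x) n.

End DegenerateBernoulli.

Section GeneratingFunction.
Variable F : numFieldType.
Implicit Types lam x : F.

Let den lam : nat -> F := fps_sub (deg_exp lam 1) (fps_one F).

Lemma deg_exp0 x : deg_exp 0 x =1 fun n => x ^+ n / n`!%:R.
Proof.
move=> n; rewrite /deg_exp /egf /gen_ffact; congr (_ / _).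
by under eq_bigr do rewrite mulr0 subr0; rewrite prodr_const card_ord.
Qed.

Lemma deg_bern_egf lam x :
  egf (fun n => deg_bern n lam x)
    =1 fps_mul (deg_bern_kernel lam) (deg_exp lam x).
Proof.
by move=> n; rewrite /egf /deg_bern mulrAC mulfV ?mul1r // pnatr_eq0 -lt0n fact_gt0.
Qed.

Lemma deg_bern_kernelP lam :
  fps_mul (deg_bern_kernel lam) (den lam) =1 fps_t F.
Proof.
have den0 : den lam 0%N = 0.
  by rewrite /den /fps_sub /deg_exp /egf /gen_ffact big_ord0 divr1 subrr.
have den1 : fps_divt (den lam) 0%N != 0.
  rewrite /fps_divt /den /fps_sub /deg_exp /egf /gen_ffact /fps_one big_ord1.
  by rewrite mul0r !subr0 divr1 oner_eq0.
case=> [|n]; rewrite /fps_mul big_ord_recr /= subnn den0 mulr0 addr0.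
  by rewrite big_ord0.
have <- : fps_one F n = fps_t F n.+1 by [].
rewrite -(fps_mulV den1); apply: eq_bigr => i _.
by rewrite /fps_divt subSn // -ltnS.
Qed.

End GeneratingFunction.

(* Main.v *)
(* Write E_x for (1 + lam t)^(x / lam) and K for the kernel t / (E_1 - 1).
   Substituting d t for t turns lam / d into lam and y / d into y, so it turns the
   kernel for lam / d into a series K' with K' (E_d - 1) = d t.  Since
   E_x E_y = E_(x + y), the sum of the E_a for a < d is geometric, with
   (E_0 + ... + E_(d - 1)) (E_1 - 1) = E_d - 1; hence
   K' (E_0 + ... + E_(d - 1)) = d K, and multiplying by E_x gives the identity. *)
Require Import Defs.
From mathcomp Require Import all_boot all_order all_algebra.
From mathcomp Require Import boolp reals.
From mathcomp.real_closed Require Import complex.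
Import Order.TTheory GRing.Theory Num.Theory.
Local Open Scope ring_scope.

Section FormalPowerSeriesRing.
Context {F : fieldType}.
Implicit Types (f g h : nat -> F) (c : F).

(** The coefficient of index [n] only sees coefficients of index at most [n], so truncating to
    polynomials lets the ring laws be inherited from [{poly F}]. *)
Lemma fps_mul_coef f g m n : (n < m)%N ->
  fps_mul f g n = ((\poly_(i < m) f i) * (\poly_(i < m) g i))`_n.
Proof.
move=> lt_nm; rewrite coefM /fps_mul; apply: eq_bigr => i _.
by rewrite !coef_poly (leq_ltn_trans _ lt_nm) ?(leq_ltn_trans _ lt_nm) ?leq_subr // -ltnS.
Qed.

Lemma fps_mulC f g : fps_mul f g = fps_mul g f.
Proof. by apply/funext => n; rewrite !(fps_mul_coef _ _ _ _ (ltnSn n)) mulrC. Qed.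

Lemma fps_mulA f g h : fps_mul f (fps_mul g h) = fps_mul (fps_mul f g) h.
Proof.
apply/funext => n.
set P := fun u : nat -> F => \poly_(i < n.+1) u i.
have PE u i : (i <= n)%N -> u i = (P u)`_i by rewrite coef_poly ltnS => ->.
transitivity ((P f * P g * P h)`_n).
  rewrite -mulrA coefM; apply: eq_bigr => i _.
  by rewrite (fps_mul_coef g h n.+1) ?ltnS ?leq_subr // -PE // -ltnS.
rewrite coefM; apply: eq_bigr => i _.
by rewrite (fps_mul_coef f g n.+1) // -PE ?leq_subr.
Qed.

Lemma fps_mul_sumr f (I : Type) (r : seq I) (u : I -> nat -> F) :
  fps_mul f (fun n => \sum_(a <- r) u a n) = fun n => \sum_(a <- r) fps_mul f (u a) n.
Proof.
apply/funext => n; rewrite /fps_mul exchange_big /=.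
by apply: eq_bigr => i _; rewrite mulr_sumr.
Qed.

Lemma fps_mulBr f g h :
  fps_mul f (fps_sub g h) = fps_sub (fps_mul f g) (fps_mul f h).
Proof.
apply/funext => n; rewrite /fps_sub /fps_mul -sumrB.
by apply: eq_bigr => i _; rewrite mulrBr.
Qed.

Lemma fps_mulZl c f g : fps_mul (fun n => c * f n) g = fun n => c * fps_mul f g n.
Proof.
apply/funext => n; rewrite /fps_mul mulr_sumr.
by apply: eq_bigr => i _; rewrite mulrA.
Qed.

Lemma fps_mul1 f : fps_mul f (fps_one F) = f.
Proof.
apply/funext => n; rewrite /fps_mul big_ord_recr /= /fps_one subnn eqxx mulr1.
by rewrite big1 ?add0r // => i _; rewrite subn_eq0 leqNgt ltn_ord mulr0.
Qed.

Lemma fps_mul_t f n : fps_mul f (fps_t F) n.+1 = f n.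
Proof.
rewrite -[RHS](congr1 (fun u => u n) (fps_mul1 f)) /fps_mul big_ord_recr /=.
rewrite /fps_t subnn mulr0 addr0; apply: eq_bigr => i _.
by rewrite subSn // -ltnS.
Qed.

Lemma fps_mul_t_inj f g : fps_mul f (fps_t F) = fps_mul g (fps_t F) -> f = g.
Proof. by move=> fg; apply/funext => n; rewrite -(fps_mul_t f) fg fps_mul_t. Qed.

(** The sequence [c ^+ n * f n] represents f(c t), and the substitution of c t for t is
    multiplicative. *)
Lemma fps_mul_dilate c f g :
  fps_mul (fun n => c ^+ n * f n) (fun n => c ^+ n * g n)
  = fun n => c ^+ n * fps_mul f g n.
Proof.
apply/funext => n; rewrite /fps_mul mulr_sumr; apply: eq_bigr => i _.
by rewrite mulrACA -exprD subnKC // -ltnS.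
Qed.

End FormalPowerSeriesRing.

Section DegenerateExponential.
Context {F : numFieldType}.
Implicit Types lam x y c : F.

Lemma deg_exp_coef0 lam x : deg_exp lam x 0 = 1.
Proof. by rewrite /deg_exp /egf /gen_ffact big_ord0 divr1. Qed.

(** Coefficient form of the differential equation (1 + lam t) E' = x E, which also covers
    [lam = 0]. *)
Lemma deg_exp_coefS lam x n :
  n.+1%:R * deg_exp lam x n.+1 = (x - n%:R * lam) * deg_exp lam x n.
Proof.
have nz : (n.+1)%:R != 0 :> F by rewrite pnatr_eq0.
rewrite /deg_exp /egf /gen_ffact big_ord_recr /= factS natrM invfM.
by rewrite [_ * (_^-1 * _)]mulrCA mulVKf // mulrAC mulrC.
Qed.

Lemma deg_expD lam x y :
  fps_mul (deg_exp lam x) (deg_exp lam y) = deg_exp lam (x + y).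
Proof.
apply/funext; elim=> [|n IHn].
  by rewrite /fps_mul big_ord1 !deg_exp_coef0 mulr1.
have nz : (n.+1)%:R != 0 :> F by rewrite pnatr_eq0.
apply: (mulfI nz); rewrite deg_exp_coefS -IHn /fps_mul !mulr_sumr.
move: (deg_exp lam x) (deg_exp lam y) (deg_exp_coefS lam x) (deg_exp_coefS lam y) => u v uS vS.
(* Leibniz rule: the factor [n.+1] is split as i + (n + 1 - i), so that each part differentiates one
   of the two series. *)
transitivity (\sum_(i < n.+2) (i%:R * u i * v (n.+1 - i)%N)
  + \sum_(i < n.+2) (u i * ((n.+1 - i)%:R * v (n.+1 - i)%N))).
  rewrite -big_split /=; apply: eq_bigr => i _.
  have /subnKC {1}<- : (i <= n.+1)%N by rewrite -ltnS.
  by rewrite natrD mulrDl !mulrA [u i * _%:R]mulrC.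
(* The first sum loses its term i = 0 and the second its term i = n + 1. Once aligned, the weights
   add up: (x - i lam) + (y - (n - i) lam) = (x + y) - n lam. *)
rewrite big_ord_recl !mul0r add0r [X in _ + X]big_ord_recr /=.
rewrite subnn mul0r mulr0 addr0 -big_split /=; apply: eq_bigr => i _.
have le_in : (i <= n)%N by rewrite -ltnS.
rewrite /bump /= add1n subSS subSn // uS vS.
by rewrite mulrCA -mulrA -mulrDl addrACA -opprD -mulrDl -natrD subnKC.
Qed.

Lemma deg_exp0r lam : deg_exp lam 0 = fps_one F.
Proof.
apply/funext => -[|n]; first exact: deg_exp_coef0.
by rewrite /deg_exp /egf /gen_ffact big_ord_recl !mul0r subrr !mul0r.
Qed.

Lemma deg_exp_dilate c lam x : deg_exp (c * lam) (c * x) = fun n => c ^+ n * deg_exp lam x n.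
Proof.
apply/funext => n; rewrite /deg_exp /egf /gen_ffact mulrA; congr (_ / _).
under eq_bigr do rewrite mulrCA -mulrBr.
by rewrite big_split /= prodr_const card_ord.
Qed.

Lemma deg_exp_geometric lam d :
  fps_mul (fps_sub (deg_exp lam 1) (fps_one F))
    (fun n => \sum_(0 <= a < d) deg_exp lam a%:R n)
  = fps_sub (deg_exp lam d%:R) (fps_one F).
Proof.
rewrite fps_mul_sumr; apply/funext => n.
(* The sum telescopes because E_a E_1 = E_(a + 1). *)
transitivity (\sum_(0 <= a < d) (deg_exp lam a.+1%:R n - deg_exp lam a%:R n)).
  apply: eq_bigr => a _.
  by rewrite fps_mulC fps_mulBr fps_mul1 deg_expD natr1.
by rewrite (telescope_sumr (fun a => deg_exp lam a%:R n)) // deg_exp0r.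
Qed.

End DegenerateExponential.

Section KernelDilation.
Variables (F : numFieldType) (lam : F) (d : nat).
Hypothesis d_gt0 : (0 < d)%N.

Let dilated_kernel : nat -> F := fun n => d%:R ^+ n * deg_bern_kernel (lam / d%:R) n.

Lemma deg_exp_div x :
  deg_exp lam x = fun n => d%:R ^+ n * deg_exp (lam / d%:R) (x / d%:R) n.
Proof.
have nz : d%:R != 0 :> F by rewrite pnatr_eq0 -lt0n.
by rewrite -deg_exp_dilate ![d%:R * _]mulrC !divfK.
Qed.

Lemma dilated_kernelP :
  fps_mul dilated_kernel (fps_sub (deg_exp lam d%:R) (fps_one F))
  = fun n => d%:R * fps_t F n.
Proof.
have nz : d%:R != 0 :> F by rewrite pnatr_eq0 -lt0n.
have -> : fps_sub (deg_exp lam d%:R) (fps_one F) = fun n => d%:R ^+ n *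
    fps_sub (deg_exp (lam / d%:R) 1) (fps_one F) n.
  apply/funext => n; rewrite deg_exp_div divff // /fps_sub mulrBr; congr (_ - _).
  (* The substitution fixes the series 1, since d^0 = 1. *)
  by case: n => [|n]; rewrite /fps_one ?mulr1 ?mulr0.
rewrite fps_mul_dilate (funext (deg_bern_kernelP _)).
by apply/funext => -[|[|n]]; rewrite /fps_t ?mulr0.
Qed.

Lemma dilated_kernel_sum :
  fps_mul dilated_kernel (fun n => \sum_(0 <= a < d) deg_exp lam a%:R n)
  = fun n => d%:R * deg_bern_kernel lam n.
Proof.
apply: fps_mul_t_inj.
(* Only the t on the left is replaced by K (E_1 - 1); the one on the right is matched by the d t
   coming from [dilated_kernelP]. *)
rewrite fps_mulZl -fps_mulA -{1}(funext (deg_bern_kernelP lam)).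
set D := fps_sub _ _; set S := (X in fps_mul X (fps_mul _ D)).
rewrite [fps_mul _ D]fps_mulC [fps_mul S _]fps_mulA.
rewrite [fps_mul S D]fps_mulC deg_exp_geometric.
by rewrite fps_mulA dilated_kernelP fps_mulZl fps_mulC.
Qed.

Lemma deg_bern_multiplication n x :
  deg_bern n lam x =
  d%:R ^ (n%:Z - 1) * \sum_(0 <= a < d) deg_bern n (lam / d%:R) ((a%:R + x) / d%:R).
Proof.
have nz : d%:R != 0 :> F by rewrite pnatr_eq0 -lt0n.
rewrite expfzDr // -exprnP exprN1 /deg_bern -mulr_sumr mulrCA; congr (_ * _).
(* Multiplying by d cancels the d^(-1) split off from d^(n - 1) and produces the d K of
   [dilated_kernel_sum]. *)
apply: (mulfI nz); rewrite [RHS]mulrCA -[RHS]mulrA mulKf // [RHS]mulr_sumr.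
have -> : d%:R * fps_mul (deg_bern_kernel lam) (deg_exp lam x) n
    = fps_mul (fun m => d%:R * deg_bern_kernel lam m) (deg_exp lam x) n.
  by rewrite fps_mulZl.
rewrite -dilated_kernel_sum.
rewrite -fps_mulA [fps_mul _ (deg_exp lam x)]fps_mulC fps_mul_sumr fps_mul_sumr.
apply: eq_bigr => a _.
by rewrite deg_expD addrC deg_exp_div fps_mul_dilate.
Qed.

End KernelDilation.

Theorem theorem2p2 (R : realType) (lam x : R[i]) (n d : nat) (d_gt0 : (0 < d)%N) :
  deg_bern n lam x =
  (d%:R : R[i]) ^ (n%:Z - 1) *
  \sum_(0 <= a < d) deg_bern n (lam / d%:R) ((a%:R + x) / d%:R).
Proof. exact: deg_bern_multiplication. Qed.
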